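(* Let $R$ be a Prüfer domain with Noetherian spectrum. Let $\mathrm{(S)Star}_{st}(R)$ be the set of stable (semi)star operations on $R$ and let $\mathcal{M}$ be the set of nondivisorial maximal ideals of $R$. (a) For any $\star\in\mathrm{(S)Star}_{st}(R)$, there are disjoint subsets $\Delta_1,\Delta_2\subseteq\mathrm{Max}(R)$ such that $\mathrm{Max}(R)=\Delta_1\cup\Delta_2$ and such that $$I^\star=\bigcap_{P\in\Delta_1}IR_P\cap\bigcap_{P\in\Delta_2}(IR_P)^{v_{R_P}}$$ for every $R$-submodule $I$ of the quotient field of $R$. (b) Endow the power set $\mathcal{P}(\mathcal{M})$ with the containment order. The map $\Phi:\mathrm{(S)Star}_{st}(R)\to\mathcal{P}(\mathcal{M})$, $\star\mapsto\mathrm{PsSpec}^{\star}(R)$, is (well-defined and) an order isomorphism. (c) $|\mathrm{(S)Star}_{st}(R)|=2^{|\mathcal{M}|}$.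
   Context: Let $R$ be an integral domain with quotient field $K$, and let $\mathbf{F}(R)$ be the set of $R$-submodules of $K$. For submodules $A,B$ of $K$, $(A:B):=\{x\in K\mid xB\subseteq A\}$. A semistar operation on $R$ is a map $\star:\mathbf{F}(R)\to\mathbf{F}(R)$, $I\mapsto I^\star$, such that for all $I,J\in\mathbf{F}(R)$ and $x\in K$: (1) $I\subseteq I^\star$; (2) $I^\star=(I^\star)^\star$; (3) if $I\subseteq J$ then $I^\star\subseteq J^\star$; (4) $(xI)^\star=x\cdot I^\star$. It is stable if $(I\cap J)^\star=I^\star\cap J^\star$ for all $I,J\in\mathbf{F}(R)$, and it is a (semi)star operation if $R^\star=R$. Semistar operations are ordered by $\star_1\leq\star_2$ iff $I^{\star_1}\subseteq I^{\star_2}$ for all $I\in\mathbf{F}(R)$. For a stable semistar operation $\star$ on $R$, the pseudo-spectrum $\mathrm{PsSpec}^{\star}(R)$ is the set of primes $P$ of $R$ such that $P^\star\cap R=R$ (i.e. $P^\star=R^\star$) and $L^\star\cap R=L$ for some $P$-primary ideal $L$ of $R$. For a domain $D$ with quotient field $K$, the $v$-operation is $v_D: H\mapsto H^{v_D}:=(D:(D:H))$ for nonzero $D$-submodules $H$ of $K$, and $(0)^{v_D}:=(0)$. An ideal $I$ of $R$ is divisorial if $I=I^{v_R}$. $\mathrm{Max}(R)$ is the set of maximal ideals of $R$. *)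

(* Defs.v *)
From HB Require Import structures.
From mathcomp Require Import all_boot all_algebra.
From mathcomp Require Import boolp classical_sets functions cardinality.

Set Implicit Arguments.
Unset Strict Implicit.
Unset Printing Implicit Defensive.

Import GRing.Theory.

Local Open Scope classical_set_scope.
Local Open Scope ring_scope.

Local Notation "x %:F" := (tofrac x).

(* Throughout, the quotient field of R is {fraction R}, and R is identified   *)
(* with its image there: an ideal of R is a submodule of {fraction R}         *)
(* contained in that image, and a%:F is the element a of R seen in the field. *)

Definition colon (K : fieldType) (A B : set K) : set K :=
  [set x | forall b, B b -> A (x * b)].

Definition prodm (K : fieldType) (A B : set K) : set K :=
  [set x | exists n (a b : 'I_n -> K),
     [/\ forall i, A (a i), forall i, B (b i) & x = \sum_(i < n) a i * b i]].

(* The case H = 0 is not redundant: for D = K the formula would give K. *)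
Definition vop (K : fieldType) (D H : set K) : set K :=
  if `[< H = [set 0] >] then [set 0] else colon D (colon D H).

Definition ring_image (R : idomainType) : set {fraction R} :=
  range (fun a : R => a%:F).
Arguments ring_image R : clear implicits.

Record is_submod (R : idomainType) (I : set {fraction R}) : Prop := IsSubmod {
  submod0 : I 0;
  submodD : forall x y, I x -> I y -> I (x + y);
  submodZ : forall (a : R) x, I x -> I (a%:F * x) }.

(* The set F(R) of the R-submodules of the quotient field. *)
Record submod (R : idomainType) := Submod {
  carrier :> set {fraction R};
  submodP : is_submod carrier }.
Arguments submod R : clear implicits.

Lemma ring_image_is_submod (R : idomainType) : is_submod (ring_image R).
Proof.
split=> [|_ _ [a _ <-] [b _ <-]|a _ [b _ <-]].
- by exists 0; rewrite ?tofrac0.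
- by exists (a + b); rewrite ?tofracD.
- by exists (a * b); rewrite ?tofracM.
Qed.

Definition ring_submod (R : idomainType) : submod R :=
  Submod (ring_image_is_submod R).
Arguments ring_submod R : clear implicits.

Lemma cap_is_submod (R : idomainType) (I J : submod R) :
  is_submod (carrier I `&` carrier J).
Proof.
case: I J => [I [I0 ID IZ]] [J [J0 JD JZ]]; split=> //=.
- by move=> x y [Ix Jx] [Iy Jy]; split; [exact: ID|exact: JD].
- by move=> a x [Ix Jx]; split; [exact: IZ|exact: JZ].
Qed.

Definition cap_submod (R : idomainType) (I J : submod R) : submod R :=
  Submod (cap_is_submod I J).

Lemma scale_is_submod (R : idomainType) (x : {fraction R}) (I : submod R) :
  is_submod [set x * y | y in carrier I].
Proof.
case: I => [I [I0 ID IZ]]; split=> /=.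
- by exists 0 => //; rewrite mulr0.
- by move=> _ _ [y Iy <-] [z Iz <-]; exists (y + z); [exact: ID|exact: mulrDr].
- by move=> a _ [y Iy <-]; exists (a%:F * y); [exact: IZ|exact: mulrCA].
Qed.

Definition scale_submod (R : idomainType) (x : {fraction R}) (I : submod R) :
  submod R := Submod (scale_is_submod x I).

Definition is_ideal (R : idomainType) (I : submod R) : Prop :=
  carrier I `<=` ring_image R.

Definition Spec (R : idomainType) : set (submod R) :=
  [set P | [/\ is_ideal P, ~ carrier P 1 &
     forall a b : R, carrier P (a * b)%:F -> carrier P a%:F \/ carrier P b%:F]].
Arguments Spec R : clear implicits.

Definition Max (R : idomainType) : set (submod R) :=
  [set M | [/\ is_ideal M, ~ carrier M 1 &
     forall J : submod R, is_ideal J -> ~ carrier J 1 ->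
       carrier M `<=` carrier J -> J = M]].
Arguments Max R : clear implicits.

(* L is P-primary; the exponent 0 is harmless since 1 is not in L. *)
Definition is_primary (R : idomainType) (P L : submod R) : Prop :=
  [/\ is_ideal L, ~ carrier L 1,
     forall a b : R, carrier L (a * b)%:F ->
       carrier L a%:F \/ exists n, carrier L (b ^+ n)%:F &
     forall a : R, carrier P a%:F <-> exists n, carrier L (a ^+ n)%:F].

Definition localization (R : idomainType) (P : submod R) : set {fraction R} :=
  [set x | exists a s : R, ~ carrier P s%:F /\ x = a%:F / s%:F].

Definition finitely_generated (R : idomainType) (I : submod R) : Prop :=
  exists n (g : 'I_n -> {fraction R}),
    carrier I = [set x | exists c : 'I_n -> R, x = \sum_(i < n) (c i)%:F * g i].

Definition invertible (R : idomainType) (I : submod R) : Prop :=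
  prodm I (colon (ring_image R) I) = ring_image R.

Definition is_prufer (R : idomainType) : Prop :=
  forall I : submod R, is_ideal I -> finitely_generated I ->
    carrier I <> [set 0] -> invertible I.

Definition zariski_closed (R : idomainType) (C : set (submod R)) : Prop :=
  exists2 I : submod R, is_ideal I &
    C = [set P | Spec R P /\ carrier I `<=` carrier P].

(* Spec(R) is a Noetherian topological space. *)
Definition noetherian_spectrum (R : idomainType) : Prop :=
  forall C : nat -> set (submod R),
    (forall n, zariski_closed (C n)) -> (forall n, C n.+1 `<=` C n) ->
    exists N, forall n, (N <= n)%N -> C n = C N.

Definition divisorial (R : idomainType) (I : submod R) : Prop :=
  carrier I = vop (ring_image R) I.

Definition nondivisorial_max (R : idomainType) : set (submod R) :=
  [set M | Max R M /\ ~ divisorial M].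
Arguments nondivisorial_max R : clear implicits.

Record is_semistar (R : idomainType) (s : submod R -> submod R) : Prop :=
  IsSemistar {
    semistar_ext : forall I, carrier I `<=` carrier (s I);
    semistar_idem : forall I, s I = s (s I);
    semistar_mono : forall I J, carrier I `<=` carrier J ->
      carrier (s I) `<=` carrier (s J);
    semistar_scale : forall (x : {fraction R}) I,
      s (scale_submod x I) = scale_submod x (s I) }.

Definition is_stable (R : idomainType) (s : submod R -> submod R) : Prop :=
  forall I J, s (cap_submod I J) = cap_submod (s I) (s J).

(* The set of the stable (semi)star operations. *)
Definition SStar_st (R : idomainType) : set (submod R -> submod R) :=
  [set s | [/\ is_semistar s, is_stable s & s (ring_submod R) = ring_submod R]].
Arguments SStar_st R : clear implicits.

Definition semistar_le (R : idomainType) (s1 s2 : submod R -> submod R) : Prop :=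
  forall I, carrier (s1 I) `<=` carrier (s2 I).

Definition PsSpec (R : idomainType) (s : submod R -> submod R) :
    set (submod R) :=
  [set P | [/\ Spec R P, carrier (s P) `&` ring_image R = ring_image R &
     exists2 L : submod R, is_primary P L &
       carrier (s L) `&` ring_image R = carrier L]].

(* Main.v *)
Require Import Defs.
From mathcomp Require Import all_boot all_algebra.
From mathcomp Require Import boolp classical_sets functions cardinality.
From mathcomp Require Import ring.

Set Implicit Arguments.
Unset Strict Implicit.
Unset Printing Implicit Defensive.

Import GRing.Theory.

Local Open Scope classical_set_scope.
Local Open Scope ring_scope.
Local Open Scope card_scope.

Local Notation "x %:F" := (@tofrac _ x).

(** The idea is to show that a stable (semi)star operation s is determined by
    the set D of the maximal ideals M with 1 in s M, and that every set D of
    nondivisorial maximal ideals occurs.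

    Stability reduces s to its value on ideals: for x != 0, x lies in s I if and
    only if 1 lies in s J, where J is the set of the r in R with r x in I
    (star_transporter).  For an ideal J, two consequences of the
    Noetherian spectrum decide whether 1 lies in s J.

    - Every element of a maximal ideal M != 0 lies in a finitely generated ideal B
      whose only prime overideal is M (fg_radical).  If B is not 0, then B is
      invertible, so s B = B.  If 1 is in s J and J R_M does not contain m in M, then m can be
      put in B, comparability in the valuation ring R_M gives J inside B, and
      1 lies in s B = B, which is absurd.  So J R_M contains M R_M for all M,
      and J R_M = R_M unless M is in D (star1_mixed_closure).
    - Conversely such a J is an intersection of finitely many members of D.
      The proof is a Noetherian induction: if J is not prime, ab in J with a
      and b outside J gives J = (J + aR) cap (J + bR), and stability applies; if
      J is prime, it is itself a member of D (mixed_closure_star1).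

    Hence s I is the intersection of the I R_M for M outside D and of the
    (I R_M : M R_M) for M in D; this is mixed_closure D I.

    A divisorial M is never in D, as s I is contained in the divisorial closure
    of I.  For a nondivisorial M, the ideal M R_M is not principal
    (nondivisorial_gap), again because of the ideals B above.  In the valuation
    ring R_M this makes M R_M idempotent, so that mixed_closure D is idempotent;
    it gives (R_M : M R_M) = R_M, so that mixed_closure D fixes R; and it makes
    (I R_M : M R_M) the divisorial closure of I R_M, which is part (a).

    Finally D is the pseudo-spectrum of s (PsSpecE): the ideal B of fg_radical
    is an M-primary ideal fixed by s, and a prime P with 1 in s P contains, by
    the description of s, each maximal ideal above it.  Parts (b) and (c)
    follow. *)

(** * Submodules of the quotient field *)

Lemma fractionW (R : idomainType) (x : {fraction R}) :
  exists a b : R, b != 0 /\ x = a%:F / b%:F.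
Proof.
elim/quotW: x => r; exists (\n_r), (\d_r); split; first exact: denom_ratioP.
have d0 : (\d_r)%:F != 0 :> {fraction R} by rewrite tofrac_eq0 denom_ratioP.
apply: (canRL (mulfK d0)); unlock tofrac; rewrite -[LHS]FracField.pi_mul.
apply/eqmodP; rewrite /= FracField.equivfE /FracField.mulf.
rewrite !numden_Ratio ?mulf_neq0 ?oner_eq0 ?denom_ratioP //.
by apply/eqP; ring.
Qed.

Lemma submod_ext (R : idomainType) (I J : submod R) :
  (forall x, carrier I x <-> carrier J x) -> I = J.
Proof.
case: I J => [I IP] [J JP] /= IJ.
have E : I = J by apply/funext => x; apply/propext.
by case: _ / E JP {IJ} => JP; rewrite (Prop_irrelevance IP JP).
Qed.

Lemma sum_is_submod (R : idomainType) (I J : submod R) :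
  is_submod [set x | exists y z, [/\ carrier I y, carrier J z & x = y + z]].
Proof.
case: I J => [I [I0 ID IZ]] [J [J0 JD JZ]]; split=> /=.
- by exists 0, 0; rewrite addr0.
- move=> _ _ [y [z [Iy Jz ->]]] [y' [z' [Iy' Jz' ->]]].
  by exists (y + y'), (z + z'); split; [exact: ID|exact: JD|rewrite addrACA].
- move=> a _ [y [z [Iy Jz ->]]].
  by exists (a%:F * y), (a%:F * z); split; [exact: IZ|exact: JZ|rewrite mulrDr].
Qed.

Definition sum_submod (R : idomainType) (I J : submod R) : submod R :=
  Submod (sum_is_submod I J).

Lemma line_is_submod (R : idomainType) (x : {fraction R}) :
  is_submod [set y | exists r : R, y = r%:F * x].
Proof.
split=> /=; first by exists 0; rewrite tofrac0 mul0r.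
- by move=> _ _ [r ->] [s ->]; exists (r + s); rewrite tofracD mulrDl.
- by move=> a _ [r ->]; exists (a * r); rewrite tofracM mulrA.
Qed.

Definition line (R : idomainType) (x : {fraction R}) : submod R :=
  Submod (line_is_submod x).

Lemma transporter_is_submod (R : idomainType) (I : submod R) (x : {fraction R}) :
  is_submod [set y | ring_image R y /\ carrier I (y * x)].
Proof.
have [R0 RD RZ] := ring_image_is_submod R.
case: I => [I [I0 ID IZ]]; split=> /=; first by rewrite mul0r.
- by move=> y z [Ry Iy] [Rz Iz]; split; [exact: RD|rewrite mulrDl; exact: ID].
- by move=> a y [Ry Iy]; split; [exact: RZ|rewrite -mulrA; exact: IZ].
Qed.

(** The ideal of R that measures the membership of x in I: x lies in I if and
    only if 1 lies in this ideal. *)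
Definition transporter (R : idomainType) (I : submod R) (x : {fraction R}) :
  submod R := Submod (transporter_is_submod I x).

(** * Prime and maximal ideals *)

Section Ideals.
Variable R : idomainType.
Implicit Types (I J L M P : submod R) (x y z : {fraction R}).

Lemma submod_sum I n (f : 'I_n -> {fraction R}) :
  (forall i, carrier I (f i)) -> carrier I (\sum_(i < n) f i).
Proof.
case: I => [I [I0 ID IZ]] /= If.
by elim/big_ind : _ => //.
Qed.

Lemma ring1 : ring_image R 1.
Proof. by exists 1; rewrite ?tofrac1. Qed.

Lemma ideal_full I x : carrier I 1 -> ring_image R x -> carrier I x.
Proof.
by move=> I1 [a _ <-]; have := submodZ (submodP I) a I1; rewrite mulr1.
Qed.

Lemma submodZr I (a : R) x : carrier I x -> carrier I (x * a%:F).
Proof. by rewrite mulrC; exact: submodZ (submodP I) a x. Qed.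

Lemma sum_submodl I J : carrier I `<=` carrier (sum_submod I J).
Proof.
by move=> x Ix; exists x, 0; split=> //; [exact: submod0 (submodP J)|rewrite addr0].
Qed.

Lemma sum_submodr I J : carrier J `<=` carrier (sum_submod I J).
Proof.
by move=> x Jx; exists 0, x; split=> //; [exact: submod0 (submodP I)|rewrite add0r].
Qed.

Lemma sum_submod_le I J L : carrier I `<=` carrier L ->
  carrier J `<=` carrier L -> carrier (sum_submod I J) `<=` carrier L.
Proof.
by move=> IL JL _ [y [z [/IL Ly /JL Lz ->]]]; exact: submodD (submodP L) _ _ Ly Lz.
Qed.

Lemma line_mem x : carrier (line x) x.
Proof. by exists 1; rewrite tofrac1 mul1r. Qed.

Lemma line_le I x : carrier I x -> carrier (line x) `<=` carrier I.
Proof. by move=> Ix _ [r ->]; exact: submodZ (submodP I) _ _ Ix. Qed.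

Lemma line_ideal (a : R) : is_ideal (line a%:F).
Proof. by apply: (@line_le (ring_submod R)); exists a. Qed.

Lemma sum_ideal I J : is_ideal I -> is_ideal J -> is_ideal (sum_submod I J).
Proof. exact: (@sum_submod_le I J (ring_submod R)). Qed.

Lemma transporter_ideal I x : is_ideal (transporter I x).
Proof. by move=> y []. Qed.

Lemma transporterP I x (a : R) :
  carrier (transporter I x) a%:F <-> carrier I (a%:F * x).
Proof. by split=> [[]//|Iax]; split=> //; exists a. Qed.

(** With a = 1 these are the proper ideals, so that the lemmas below treat primes
    away from a and maximal ideals together. *)
Definition avoids I (a : R) := is_ideal I /\ forall n, ~ carrier I (a ^+ n)%:F.

(** Zorn; a union of a nonempty chain of ideals avoiding the powers of a still
    avoids them. *)
Lemma ex_maximal_avoiding I (a : R) : avoids I a ->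
  exists P, [/\ avoids P a, carrier I `<=` carrier P &
    forall J, avoids J a -> carrier P `<=` carrier J -> J = P].
Proof.
move=> Ia.
pose T := {J : submod R | avoids J a /\ carrier I `<=` carrier J}.
pose le (s t : T) := `[< carrier (sval s) `<=` carrier (sval t) >].
have [||||t tmax] := @Zorn T le.
- by move=> t; apply/asboolP.
- by move=> r s t /asboolP rs /asboolP st; apply/asboolP; exact: subset_trans st.
- move=> [s sP] [t tP] /asboolP /= st /asboolP /= ts.
  by apply: eq_exist; apply: submod_ext => x; split; [exact: st|exact: ts].
- move=> A Atot; have [[s0 As0]|A0] := pselect (exists s, A s); last first.
    have IP : avoids I a /\ carrier I `<=` carrier I by split.
    by exists (exist _ I IP) => s As; case: A0; exists s.
  pose U := [set x | exists2 s, A s & carrier (sval s) x].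
  have UP : is_submod U.
    split.
    - by exists s0 => //; exact: submod0 (submodP _).
    - move=> x y [s As sx] [t At ty].
      have [/asboolP st|/asboolP ts] := Atot s t As At.
        by exists t => //; apply: (submodD (submodP _)) => //; exact: st.
      by exists s => //; apply: (submodD (submodP _)) => //; exact: ts.
    - by move=> b x [s As sx]; exists s => //; exact: submodZ (submodP _) _ _ sx.
  have UA : avoids (Submod UP) a /\ carrier I `<=` carrier (Submod UP).
    split; first split.
    - by move=> x [s _]; case: (svalP s) => -[sR _] _; exact: sR.
    - by move=> n [s _]; case: (svalP s) => -[_ sa] _; exact: sa.
    - by move=> x Ix; exists s0 => //; case: (svalP s0) => _; exact.
  by exists (exist _ (Submod UP) UA) => s As; apply/asboolP => x sx; exists s.
exists (sval t); case: (svalP t) => ta It; split=> // J Ja tJ.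
have JP : avoids J a /\ carrier I `<=` carrier J by split=> //; exact: subset_trans tJ.
have E : exist _ J JP = t by apply: tmax; exact/asboolP.
by rewrite -E.
Qed.

(** If u and v are outside P, then P + uR contains some a^n and P + vR some a^m;
    multiplying, uv in P would put a^(n+m) in P. *)
Lemma maximal_avoiding_prime P (a : R) : avoids P a ->
  (forall J, avoids J a -> carrier P `<=` carrier J -> J = P) -> Spec R P.
Proof.
move=> [PR Pa] Pmax; split=> // [|u v Puv]; first by have := Pa 0; rewrite expr0 tofrac1.
have grow w : carrier P w%:F \/ exists n p r, carrier P p%:F /\ a ^+ n = p + r * w.
  have [[n [y [z [Py [r ->] E]]]]|Pw] :=
      pselect (exists n, carrier (sum_submod P (line w%:F)) (a ^+ n)%:F).
    right; have [p _ pE] := PR _ Py.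
    exists n, p, r; split; first by rewrite pE.
    by apply/eqP; rewrite -tofrac_eq tofracD tofracM pE E.
  left; rewrite -(Pmax (sum_submod P (line w%:F))); last exact: sum_submodl.
    by apply: sum_submodr; exact: line_mem.
  split; first by apply: sum_ideal => //; exact: line_ideal.
  by move=> n Pn; apply: Pw; exists n.
have [|[n [p [r [Pp En]]]]] := grow u; first by left.
have [|[m [q [s [Pq Em]]]]] := grow v; first by right.
case: (Pa (n + m)%N); rewrite exprD En Em.
have -> : (p + r * u) * (q + s * v) = (q + s * v) * p + (r * u) * q + r * s * (u * v).
  by ring.
rewrite !tofracD [(_ * p)%:F]tofracM [(_ * q)%:F]tofracM [(_ * (u * v))%:F]tofracM.
by do 2?[apply: (submodD (submodP P))]; exact: (submodZ (submodP P)).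
Qed.

Lemma avoids1 I : is_ideal I -> ~ carrier I 1 -> avoids I 1.
Proof. by move=> IR I1; split=> // n; rewrite expr1n tofrac1. Qed.

Lemma avoids1N I : avoids I 1 -> ~ carrier I 1.
Proof. by move=> [_ /(_ 0%N)]; rewrite expr0 tofrac1. Qed.

Lemma maximal_prime M : Max R M -> Spec R M.
Proof.
move=> [MR M1 Mmax]; apply: (@maximal_avoiding_prime _ 1); first exact: avoids1.
by move=> J /[dup] -[JR _] /avoids1N J1; exact: Mmax.
Qed.

Lemma ex_prime I (a : R) : avoids I a ->
  exists P, [/\ Spec R P, carrier I `<=` carrier P & ~ carrier P a%:F].
Proof.
move=> /ex_maximal_avoiding[P [Pa IP Pmax]]; exists P; split=> //.
  exact: maximal_avoiding_prime Pmax.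
by case: Pa => _ /(_ 1%N); rewrite expr1.
Qed.

Lemma ex_max I : is_ideal I -> ~ carrier I 1 ->
  exists2 M, Max R M & carrier I `<=` carrier M.
Proof.
move=> IR /(avoids1 IR) /ex_maximal_avoiding[M [M1 IM Mmax]]; exists M => //.
split; [by case: M1|exact: avoids1N|].
by move=> J JR J1; apply: Mmax; exact: avoids1.
Qed.

End Ideals.

(** * Noetherian spectrum, invertible ideals, comparability at a prime *)

Section Invertible.
Variable R : idomainType.
Implicit Types (I J L M P B : submod R) (x y z : {fraction R}).

(** An ideal counts as larger only when it loses a prime overideal: the
    spectrum sees ideals up to radical, and ideals themselves need not satisfy
    the ascending chain condition. A counterexample would start a strictly
    decreasing sequence of closed sets. *)
Lemma noetherian_ideal_ind (Q : submod R -> Prop) : noetherian_spectrum R ->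
  (forall I, is_ideal I ->
    (forall J, is_ideal J -> carrier I `<=` carrier J ->
      (exists P, [/\ Spec R P, carrier I `<=` carrier P &
                     ~ carrier J `<=` carrier P]) -> Q J) -> Q I) ->
  forall I, is_ideal I -> Q I.
Proof.
move=> hn step I IR; apply: contrapT => QI.
pose T := {J : submod R | is_ideal J /\ ~ Q J}.
have next (s : T) : exists t : T, carrier (sval s) `<=` carrier (sval t) /\
    exists P, [/\ Spec R P, carrier (sval s) `<=` carrier P &
                  ~ carrier (sval t) `<=` carrier P].
  case: s => [J [JR QJ]] /=; apply: contrapT => nt; apply: QJ.
  apply: step => // L LR JL LP; apply: contrapT => QL; apply: nt.
  by exists (exist _ L (conj LR QL)).
have [f fP] := choice next.
pose c n := iter n f (exist _ I (conj IR QI) : T).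
have [|n P|N CN] := hn (fun n => [set P | Spec R P /\ carrier (sval (c n)) `<=` carrier P]).
- by move=> n; exists (sval (c n)) => //; case: (svalP (c n)).
- by move=> [SP cP]; split=> //; apply: subset_trans cP; case: (fP (c n)).
have [_ [P [SP cP ncP]]] := fP (c N); apply: ncP.
suff [] : [set P | Spec R P /\ carrier (sval (c N.+1)) `<=` carrier P] P by [].
by rewrite (CN N.+1).
Qed.

Lemma fg_line x : finitely_generated (line x).
Proof.
exists 1%N, (fun=> x); apply/seteqP; split=> y /=.
  by move=> [r ->]; exists (fun=> r); rewrite big_ord1.
by move=> [c ->]; exists (c ord0); rewrite big_ord1.
Qed.

Lemma fg_sum_line I x : finitely_generated I ->
  finitely_generated (sum_submod I (line x)).
Proof.
move=> [n [g gI]].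
exists n.+1, (fun i => if unlift ord0 i is Some j then g j else x).
apply/seteqP; split=> y /=.
  rewrite gI => -[_ [_ [[c ->] [r ->] ->]]].
  exists (fun i => if unlift ord0 i is Some j then c j else r).
  rewrite big_ord_recl unlift_none addrC; congr (_ + _).
  by apply: eq_bigr => i _; rewrite liftK.
move=> [c ->]; rewrite big_ord_recl unlift_none addrC.
exists (\sum_(i < n) (c (lift ord0 i))%:F * g i), ((c ord0)%:F * x); split.
- by rewrite gI; exists (fun i => c (lift ord0 i)).
- by exists (c ord0).
- by congr (_ + _); apply: eq_bigr => i _; rewrite liftK.
Qed.

(** Write 1 as a sum of b_i c_i with b_i in B and c_i in its inverse; then x is
    the sum of the b_i (x c_i). *)
Lemma invertible_reflexive B x : invertible B ->
  (forall c, colon (ring_image R) B c -> ring_image R (x * c)) -> carrier B x.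
Proof.
move=> Binv xc; have := ring1 R; rewrite -Binv => -[n [b [c [Bb Cc E]]]].
rewrite -[x]mulr1 E mulr_sumr; apply: submod_sum => i.
rewrite [b i * _]mulrC mulrA; have [r _ <-] := xc _ (Cc i).
exact: submodZ (submodP B) _ _ (Bb i).
Qed.

(** R_P is a valuation ring. As (a, b) is invertible, 1 = a u + b v where a, b
    times u, v lie in R; one of a u, b v is outside P, and it serves as t. *)
Lemma prufer_dvd_ring P (a b : R) : is_prufer R -> Spec R P ->
  exists2 t : R, ~ carrier P t%:F &
    (exists r, t * a = r * b) \/ (exists r, t * b = r * a).
Proof.
move=> hp [PR P1 Pprime].
have [->|a0] := eqVneq a 0.
  by exists 1; rewrite ?tofrac1//; left; exists 0; rewrite mulr0 mul0r.
pose I := sum_submod (line a%:F) (line b%:F).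
have Ia : carrier I a%:F by apply: sum_submodl; exact: line_mem.
have Ib : carrier I b%:F by apply: sum_submodr; exact: line_mem.
have Iinv : invertible I.
  apply: hp; first by apply: sum_ideal; exact: line_ideal.
    by apply: fg_sum_line; exact: fg_line.
  by move=> I0; move: Ia; rewrite I0 /= => /eqP; rewrite tofrac_eq0 (negPf a0).
pose C := colon (ring_image R) I.
have [R0 RD RZ] := ring_image_is_submod R.
have [u [v [Cu Cv E1]]] : exists u v, [/\ C u, C v & 1 = a%:F * u + b%:F * v].
  have := ring1 R; rewrite -Iinv => -[n [i [j [Ii Cj ->]]]].
  elim/big_ind: _ => [|_ _ [u [v [Cu Cv ->]]] [u' [v' [Cu' Cv' ->]]]|k _].
  - by exists 0, 0; rewrite !mulr0 addr0; split=> // y _; rewrite mul0r.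
  - exists (u + u'), (v + v'); rewrite !mulrDr addrACA.
    by split=> // y Iy; rewrite mulrDl; apply: RD; auto.
  - have [_ [_ [[r ->] [s ->] ->]]] := Ii k.
    exists (r%:F * j k), (s%:F * j k); split.
    + by move=> y Iy; rewrite -mulrA; apply: RZ; exact: Cj.
    + by move=> y Iy; rewrite -mulrA; apply: RZ; exact: Cj.
    + by ring.
have [au _ auE] := Cu _ Ia; have [bu _ buE] := Cu _ Ib.
have [av _ avE] := Cv _ Ia; have [bv _ bvE] := Cv _ Ib.
have E : au + bv = 1.
  by apply/eqP; rewrite -tofrac_eq tofracD auE bvE tofrac1 E1; apply/eqP; ring.
have [Pau|Pau] := pselect (carrier P au%:F); last first.
  exists au => //; right; exists bu; apply/eqP; rewrite -tofrac_eq !tofracM auE buE.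
  by apply/eqP; ring.
exists bv; last first.
  left; exists av; apply/eqP; rewrite -tofrac_eq !tofracM avE bvE.
  by apply/eqP; ring.
move=> Pbv; apply: P1; rewrite -tofrac1 -E tofracD.
exact: submodD (submodP P) _ _ _ _.
Qed.

Lemma eq_cross_mul (K : fieldType) (t a b c d r : K) : b != 0 -> d != 0 ->
  t * (a * d) = r * (c * b) -> t * (a / b) = r * (c / d).
Proof.
move=> b0 d0 E; apply: (mulIf b0); apply: (mulIf d0).
transitivity (t * (a * d)); first by field.
by rewrite E; field.
Qed.

Lemma prufer_dvd P x y : is_prufer R -> Spec R P ->
  exists2 t : R, ~ carrier P t%:F &
    (exists r : R, t%:F * x = r%:F * y) \/ (exists r : R, t%:F * y = r%:F * x).
Proof.
move=> hp SP.
have [a [b [b0 ->]]] := fractionW x; have [c [d [d0 ->]]] := fractionW y.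
have bF : b%:F != 0 :> {fraction R} by rewrite tofrac_eq0.
have dF : d%:F != 0 :> {fraction R} by rewrite tofrac_eq0.
have [t Pt tE] := prufer_dvd_ring (a * d) (c * b) hp SP.
exists t => //.
by case: tE => -[r /(congr1 (@tofrac R))]; rewrite !tofracM => E; [left|right];
  exists r; exact: eq_cross_mul.
Qed.

(** Adjoin to aR elements of M outside a prime overideal of the current ideal;
    by the Noetherian spectrum this stops. *)
Lemma fg_radical M (a : R) : noetherian_spectrum R ->
  is_ideal M -> carrier M a%:F ->
  exists B, [/\ finitely_generated B, carrier B `<=` carrier M, carrier B a%:F &
    forall P, Spec R P -> carrier B `<=` carrier P -> carrier M `<=` carrier P].
Proof.
move=> hn MR Ma.
pose Q B := finitely_generated B -> carrier B `<=` carrier M -> carrier B a%:F ->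
  exists B, [/\ finitely_generated B, carrier B `<=` carrier M, carrier B a%:F &
    forall P, Spec R P -> carrier B `<=` carrier P -> carrier M `<=` carrier P].
apply: (@noetherian_ideal_ind Q hn _ (line a%:F)).
- move=> B BR IH Bfg BM Ba; apply: contrapT => nB; apply: (nB); exists B; split=> //.
  move=> P SP BP m Mm; apply: contrapT => Pm.
  have BmM : carrier (sum_submod B (line m)) `<=` carrier M.
    by apply: sum_submod_le => //; exact: line_le.
  apply: nB; apply: (IH (sum_submod B (line m))).
  + exact: subset_trans MR.
  + exact: sum_submodl.
  + exists P; split=> // BmP; apply: Pm; apply: BmP; apply: sum_submodr.
    exact: line_mem.
  + exact: fg_sum_line.
  + by [].
  + exact: sum_submodl.
- exact: line_ideal.
- exact: fg_line.
- exact: line_le.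
- exact: line_mem.
Qed.

End Invertible.

(** * Localizations of a submodule *)

(** As R - P is multiplicative, this is I R_P inside the quotient field
    (prodm_localization). *)
Definition loc (R : idomainType) (P I : submod R) : set {fraction R} :=
  [set x | exists2 t : R, ~ carrier P t%:F & carrier I (t%:F * x)].

(** The submodule (I R_P : P R_P). *)
Definition almost_loc (R : idomainType) (P I : submod R) : set {fraction R} :=
  [set x | forall m : R, carrier P m%:F -> loc P I (m%:F * x)].

Definition mixed_closure (R : idomainType) (D : set (submod R))
    (I : submod R) : set {fraction R} :=
  [set x | forall M, Max R M ->
    (~ D M -> loc M I x) /\ (D M -> almost_loc M I x)].

Section Localization.
Variable R : idomainType.
Implicit Types (I J L M N P B : submod R) (x y z : {fraction R}).
Implicit Types (D : set (submod R)).

Lemma prime_notM P (a b : R) : Spec R P -> ~ carrier P a%:F -> ~ carrier P b%:F ->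
  ~ carrier P (a * b)%:F.
Proof. by move=> [_ _ Pp] Pa Pb /Pp[]. Qed.

Lemma prime_not1 P : Spec R P -> ~ carrier P (1 : R)%:F.
Proof. by move=> [_ P1 _]; rewrite tofrac1. Qed.

Lemma sub_loc P I : Spec R P -> carrier I `<=` loc P I.
Proof.
by move=> SP x Ix; exists 1; [exact: prime_not1|rewrite tofrac1 mul1r].
Qed.

Lemma loc_mono P I J : carrier I `<=` carrier J -> loc P I `<=` loc P J.
Proof. by move=> IJ x [t Pt /IJ]; exists t. Qed.

Lemma loc_is_submod P I : Spec R P -> is_submod (loc P I).
Proof.
move=> SP; have [I0 ID IZ] := submodP I; split.
- exact: sub_loc.
- move=> x y [t Pt Ix] [u Pu Iy]; exists (t * u); first exact: prime_notM.
  rewrite mulrDr tofracM; apply: ID; last by rewrite -mulrA; exact: IZ.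
  by rewrite mulrAC; exact: submodZr.
- by move=> a x [t Pt Ix]; exists t => //; rewrite mulrCA; exact: IZ.
Qed.

Lemma locK P I x (t : R) : Spec R P -> ~ carrier P t%:F -> loc P I (t%:F * x) ->
  loc P I x.
Proof.
move=> SP Pt [u Pu Iutx]; exists (u * t); first exact: prime_notM.
by rewrite tofracM -mulrA.
Qed.

Lemma loc_cap P I J x : Spec R P ->
  loc P (cap_submod I J) x <-> loc P I x /\ loc P J x.
Proof.
move=> SP; split=> [[t Pt [Ix Jx]]|[[t Pt Ix] [u Pu Jx]]].
  by split; exists t.
exists (t * u); first exact: prime_notM.
rewrite tofracM; split; last by rewrite -mulrA; exact: submodZ (submodP J) _ _ _.
by rewrite mulrAC; exact: submodZr.
Qed.

Lemma sub_almost_loc P I : Spec R P -> loc P I `<=` almost_loc P I.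
Proof. by move=> SP x Ix m _; exact: submodZ (loc_is_submod I SP) _ _ Ix. Qed.

Lemma almost_loc_is_submod P I : Spec R P -> is_submod (almost_loc P I).
Proof.
move=> SP; have [I0 ID IZ] := loc_is_submod I SP; split.
- by move=> m _; rewrite mulr0.
- by move=> x y Ix Iy m Pm; rewrite mulrDr; apply: ID; [exact: Ix|exact: Iy].
- by move=> a x Ix m Pm; rewrite mulrCA; apply: IZ; exact: Ix.
Qed.

Lemma mixed_closure_is_submod D I : is_submod (mixed_closure D I).
Proof.
split=> [M /maximal_prime SM|x y Ix Iy M MM|a x Ix M MM].
- by split=> _; [exact: submod0 (loc_is_submod _ _)|
    exact: submod0 (almost_loc_is_submod _ _)].
- have SM := maximal_prime MM; have [Ix1 Ix2] := Ix _ MM; have [Iy1 Iy2] := Iy _ MM.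
  split=> DM; first by apply: (submodD (loc_is_submod I SM)); auto.
  by apply: (submodD (almost_loc_is_submod I SM)); auto.
- have SM := maximal_prime MM; have [Ix1 Ix2] := Ix _ MM.
  split=> DM; first by apply: (submodZ (loc_is_submod I SM)); auto.
  by apply: (submodZ (almost_loc_is_submod I SM)); auto.
Qed.

Lemma mixed_closure_mono D I J : carrier I `<=` carrier J ->
  mixed_closure D I `<=` mixed_closure D J.
Proof.
move=> IJ x Ix M /Ix[Ix1 Ix2]; split=> DM; first exact: loc_mono (Ix1 DM).
by move=> m Mm; apply: loc_mono IJ _ (Ix2 DM m Mm).
Qed.

Lemma loc_transporter P I x (a : R) :
  loc P (transporter I x) a%:F <-> loc P I (a%:F * x).
Proof.
split=> -[t Pt]; first by rewrite -tofracM => /transporterP It; exists t => //;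
  rewrite mulrA -tofracM.
by move=> It; exists t => //; rewrite -tofracM; apply/transporterP;
  rewrite tofracM -mulrA.
Qed.

(** The same reduction to ideals as star_transporter. *)
Lemma mixed_closure_transporter D I x :
  mixed_closure D I x <-> mixed_closure D (transporter I x) 1.
Proof.
have E P : loc P (transporter I x) 1 <-> loc P I x.
  by have := loc_transporter P I x 1; rewrite tofrac1 mul1r.
split=> Ix M /Ix[Ix1 Ix2]; split=> DM; try by apply/E; auto.
  by move=> m Mm; rewrite mulr1; apply/loc_transporter; exact: Ix2.
by move=> m Mm; apply/loc_transporter; rewrite -[m%:F]mulr1; exact: Ix2.
Qed.

(** The strong form of comparability in R_P: if x is outside I R_P, then I R_P
    lies in x P R_P, and not merely in x R_P. *)
Lemma loc_dvd P I x y : is_prufer R -> Spec R P -> ~ loc P I x -> carrier I y ->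
  exists t r : R, [/\ ~ carrier P t%:F, carrier P r%:F & t%:F * y = r%:F * x].
Proof.
move=> hp SP Ix Iy; have IZ := submodZ (submodP I).
have [t Pt [[r E]|[r E]]] := prufer_dvd x y hp SP.
  by case: Ix; exists t => //; rewrite E; exact: IZ.
exists t, r; split=> //; apply: contrapT => Pr; apply: Ix; exists r => //.
by rewrite -E; exact: IZ.
Qed.

(** Otherwise the ideal of the r with r x in I is proper, and any maximal ideal
    above it will do. *)
Lemma loc_global I x : carrier I x \/ exists2 M, Max R M & ~ loc M I x.
Proof.
have [I1|/ex_max[|M MM IM]] := pselect (carrier (transporter I x) 1).
- by left; move: I1; rewrite -tofrac1 => /transporterP; rewrite tofrac1 mul1r.
- exact: transporter_ideal.
- by right; exists M => // -[t Mt It]; apply: Mt; apply: IM; apply/transporterP.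
Qed.

Lemma sub_not_loc P B (a : R) : is_ideal B -> ~ loc P B a%:F ->
  carrier B `<=` carrier P.
Proof.
move=> BR Pa x Bx; apply: contrapT => Px; apply: Pa.
have [b _ bE] := BR _ Bx; exists b; rewrite ?bE//.
exact: submodZr.
Qed.

(** When M is the only prime overideal of B, membership in B has to be checked
    at M only. *)
Lemma not_loc_isolated M N B (a : R) : Max R M -> is_ideal B ->
  (forall P, Spec R P -> carrier B `<=` carrier P -> carrier M `<=` carrier P) ->
  Max R N -> ~ loc N B a%:F -> N = M.
Proof.
move=> [_ _ Mmax] BR Brad NM nBa; have [NR N1 _] := NM.
apply: Mmax => //; apply: Brad; first exact: maximal_prime.
exact: sub_not_loc nBa.
Qed.

End Localization.

(** * Stable star operations are mixed closures *)

Section StableStar.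
Variable R : idomainType.
Implicit Types (I J L M N P B : submod R) (x y z : {fraction R}).
Implicit Types (D : set (submod R)).
Variable s : submod R -> submod R.
Hypothesis hs : SStar_st R s.

Let s_semistar : is_semistar s. Proof. by case: hs. Qed.
Let s_stable : is_stable s. Proof. by case: hs. Qed.
Let s_star : s (ring_submod R) = ring_submod R. Proof. by case: hs. Qed.

(** In particular s B lies in the divisorial closure of B, since c B inside R
    gives c (s B) inside s R = R. *)
Lemma star_colon B x c : carrier (s B) x -> colon (ring_image R) B c ->
  ring_image R (x * c).
Proof.
move=> sBx Bc; suff : carrier (s (ring_submod R)) (x * c) by rewrite s_star.
apply: (semistar_mono s_semistar (I := scale_submod c B)).
  by move=> _ [y By <-]; exact: Bc.
by rewrite (semistar_scale s_semistar); exists x => //; rewrite mulrC.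
Qed.

Lemma star_invertible B : invertible B -> carrier (s B) `<=` carrier B.
Proof.
by move=> Binv x sBx; apply: invertible_reflexive => // c; exact: star_colon.
Qed.

Lemma star_zero I x : carrier I = [set 0] -> carrier (s I) x -> x = 0.
Proof.
move=> I0; have <- : scale_submod 0 I = I.
  apply: submod_ext => y; rewrite I0 /=; split=> [[z _ <-]|->]; first by rewrite mul0r.
  by exists 0; rewrite ?mul0r ?I0.
by rewrite (semistar_scale s_semistar) => -[z _ <-]; rewrite mul0r.
Qed.

Lemma star_divisorial M : divisorial M -> carrier (s M) 1 -> carrier M 1.
Proof.
rewrite /divisorial /vop => -> sM1; case: asboolP => M0.
  exact: star_zero sM1.
by move=> c Mc; exact: (star_colon sM1 Mc).
Qed.

(** Apply s to the identity x J = I cap x R, where J is the transporter. *)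
Lemma star_transporter I x : x != 0 ->
  carrier (s I) x <-> carrier (s (transporter I x)) 1.
Proof.
move=> x0.
have E : scale_submod x (transporter I x) =
    cap_submod I (scale_submod x (ring_submod R)).
  apply: submod_ext => y; split=> /= [[z [Rz Iz] <-]|[Iy [z Rz zE]]].
    by split; [rewrite mulrC|exists z].
  by exists z => //; split=> //; rewrite mulrC zE.
have := semistar_scale s_semistar x (transporter I x).
rewrite E s_stable (semistar_scale s_semistar) s_star => /(congr1 (@carrier R)) /= {}E.
split=> [sIx|sT1].
  have : (carrier (s I) `&` [set x * y | y in ring_image R]) x.
    by split=> //; exists 1; rewrite ?mulr1//; exact: ring1.
  by rewrite E => -[y sTy]; rewrite -[RHS]mulr1 => /(mulfI x0) <-.
suff [] : (carrier (s I) `&` [set x * y | y in ring_image R]) x by [].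
by rewrite E; exists 1; rewrite ?mulr1.
Qed.

Let D := [set M | Max R M /\ carrier (s M) 1].

Lemma star_not_below B J : invertible B -> ~ carrier B 1 -> carrier (s J) 1 ->
  ~ carrier J `<=` carrier B.
Proof.
move=> Binv B1 sJ1 JB; apply: B1; apply: star_invertible => //.
exact: semistar_mono s_semistar _ _ JB _ sJ1.
Qed.

(** If m in M were outside J R_M, then J would lie in a finitely generated
    proper ideal B containing m and isolated at M: at M because J R_M is inside
    m R_M, elsewhere because B localizes to the whole ring. Such a B is
    invertible, hence s B = B. *)
Lemma star1_mixed_closure J : is_prufer R -> noetherian_spectrum R ->
  is_ideal J -> carrier (s J) 1 -> mixed_closure D J 1.
Proof.
move=> hp hn JR sJ1 M MM; have SM := maximal_prime MM.
have [MR M1 Mmax] := MM.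
split=> [DM|[_ sM1] m Mm].
  apply: contrapT => Jloc; apply: DM; split=> //.
  apply: semistar_mono s_semistar _ _ _ _ sJ1 => x Jx; have [a _ aE] := JR _ Jx.
  apply: contrapT => Mx; apply: Jloc; exists a; first by rewrite aE.
  by rewrite aE mulr1.
rewrite mulr1; apply: contrapT => Jm.
have [B [Bfg BM Bm Brad]] := fg_radical hn MR Mm.
have BR : is_ideal B by exact: subset_trans MR.
have Binv : invertible B.
  apply: hp => // B0; apply: Jm; move: Bm; rewrite B0 /= => ->.
  exact: submod0 (loc_is_submod _ _).
apply: (star_not_below Binv _ sJ1) => [/BM //|j Jj].
have [//|[N NM nBj]] := loc_global B j.
have [a _ aE] := JR _ Jj.
rewrite -aE in nBj; have NME := not_loc_isolated MM BR Brad NM nBj.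
case: nBj; rewrite NME aE.
have [t [r [Mt _ E]]] := loc_dvd hp SM Jm Jj.
by exists t => //; rewrite E; exact: submodZ (submodP B) _ _ Bm.
Qed.

(** The local hypothesis makes J a radical ideal (claim away) all of whose
    maximal overideals are in D. Noetherian induction splits such a J into
    members of D, and s commutes with finite intersections. *)
Lemma mixed_closure_star1 J : noetherian_spectrum R -> is_ideal J ->
  mixed_closure D J 1 -> carrier (s J) 1.
Proof.
move=> hn; pose Q J := mixed_closure D J 1 -> carrier (s J) 1.
apply: (@noetherian_ideal_ind R Q hn) => {}J JR IH JD.
have JDM M : Max R M -> carrier J `<=` carrier M -> D M.
  move=> MM JM; apply: contrapT => DM; have [[] // t Mt Jt _] := JD M MM.
  by apply: Mt; apply: JM; rewrite mulr1 in Jt.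
(* J is the intersection of the maximal ideals above it: one that contains
   (J : a) cannot contain a, because J R_M contains M R_M. *)
have away (a : R) : ~ carrier J a%:F -> exists2 M, Max R M &
    carrier J `<=` carrier M /\ ~ carrier M a%:F.
  move=> Ja; have [|M MM JaM] := @ex_max R (transporter J a%:F) (@transporter_ideal R J a%:F).
    by rewrite -tofrac1 => /transporterP; rewrite tofrac1 mul1r.
  have JM : carrier J `<=` carrier M.
    move=> x Jx; apply: JaM; have [b _ bE] := JR _ Jx.
    by rewrite -bE; apply/transporterP; rewrite bE; exact: submodZr.
  exists M => //; split=> // Ma.
  have [_ /(_ (JDM M MM JM) a Ma)[t Mt]] := JD M MM.
  by rewrite mulr1 => /transporterP /JaM.
have [J1|J1] := pselect (carrier J 1); first exact: semistar_ext s_semistar _ _ J1.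
have [M0 MM0 JM0] := ex_max JR J1.
have [[a [b [Jab Ja Jb]]]|Jprime] := pselect (exists a b : R,
    [/\ carrier J (a * b)%:F, ~ carrier J a%:F & ~ carrier J b%:F]).
  have grow (c : R) : ~ carrier J c%:F ->
      carrier (s (sum_submod J (line c%:F))) 1.
    move=> Jc; apply: IH.
    - by apply: sum_ideal => //; exact: line_ideal.
    - exact: sum_submodl.
    - have [M MM [JM Mc]] := away c Jc; exists M; split=> //.
        exact: maximal_prime.
      by move=> JcM; apply: Mc; apply: JcM; apply: sum_submodr; exact: line_mem.
    - by apply: mixed_closure_mono JD; exact: sum_submodl.
  have : carrier (s (cap_submod (sum_submod J (line a%:F)) (sum_submod J (line b%:F)))) 1.
    by rewrite s_stable; split; exact: grow.
  apply: (semistar_mono s_semistar) => x [[y [_ [Jy [r ->] xE]]] [z [_ [Jz [q ->] xE']]]].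
  (* x^2 lies in (J + aR)(J + bR), hence in J, and J is radical. *)
  apply: contrapT => Jx.
  have [c cE] : exists c : R, x = c%:F.
    have [u _ uE] := JR _ Jy; exists (u + r * a); rewrite xE.
    by rewrite tofracD tofracM uE.
  rewrite cE in Jx xE xE'; have [M MM [JM Mc]] := away c Jx.
  apply: (prime_notM (maximal_prime MM) Mc Mc); apply: JM.
  have -> : (c * c)%:F = c%:F * y + (r * a)%:F * z + (r * q)%:F * (a * b)%:F.
    by rewrite !tofracM {2}xE mulrDr -addrA; congr (_ + _); rewrite {1}xE'; ring.
  have [_ JDD JZ] := submodP J.
  by apply: (JDD); [apply: JDD|]; exact: JZ.
have JM : J = M0.
  apply: submod_ext => x; split=> [/JM0 //|M0x].
  have [a _ aE] : ring_image R x by case: MM0 => M0R _ _; exact: M0R.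
  have [_ /(_ (JDM _ MM0 JM0) a)[|t M0t]] := JD M0 MM0; first by rewrite aE.
  rewrite mulr1 -tofracM => Jta; apply: contrapT => Jx; apply: Jprime.
  by exists t, a; split; rewrite ?aE// => /JM0.
by rewrite JM; case: (JDM _ MM0 JM0).
Qed.

Lemma star_mixed_closure I : is_prufer R -> noetherian_spectrum R ->
  carrier (s I) = mixed_closure D I.
Proof.
move=> hp hn; apply/seteqP.
suff H x : carrier (s I) x <-> mixed_closure D I x by split=> x /H.
have [->|x0] := eqVneq x 0.
  by split=> _; [exact: submod0 (mixed_closure_is_submod _ _)|
    exact: submod0 (submodP _)].
apply: (iff_trans (star_transporter I x0)).
apply: iff_trans (iff_sym (mixed_closure_transporter D I x)).
have TR := @transporter_ideal R I x.
by split; [exact: star1_mixed_closure|exact: mixed_closure_star1].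
Qed.

End StableStar.

(** * Nondivisorial maximal ideals *)

Section Nondivisorial.
Variable R : idomainType.
Implicit Types (I J L M N P B : submod R) (x y z : {fraction R}).
Implicit Types (D : set (submod R)).

Lemma nondivisorial_neq0 M : nondivisorial_max R M ->
  exists2 a : R, a != 0 & carrier M a%:F.
Proof.
move=> [MM Mdiv]; apply: contrapT => M0; apply: Mdiv; rewrite /divisorial /vop.
suff E : carrier M = [set 0] by rewrite -E; case: asboolP.
apply/seteqP; split=> x /= => [Mx|->]; last exact: submod0 (submodP M).
apply: contrapT => /eqP x0; apply: M0; case: MM => /(_ _ Mx)[a _ aE] _ _.
by exists a; rewrite ?aE// -tofrac_eq0 aE.
Qed.

Lemma invertible_divisorial B : carrier B <> [set 0] -> invertible B -> divisorial B.
Proof.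
move=> B0 Binv; rewrite /divisorial /vop; case: asboolP => // _.
apply/seteqP; split=> x Bx; last exact: invertible_reflexive.
by move=> c Bc; rewrite mulrC; exact: Bc.
Qed.

(** M R_M is not principal: if it were p R_M, a finitely generated ideal
    containing p and isolated at M would agree with M locally everywhere, so M
    would be invertible, hence divisorial. *)
Lemma nondivisorial_gap M (p : R) : is_prufer R -> noetherian_spectrum R ->
  nondivisorial_max R M -> carrier M p%:F ->
  exists2 m : R, carrier M m%:F & ~ loc M (line p%:F) m%:F.
Proof.
move=> hp hn Mnd Mp; have [a a0 Ma] := nondivisorial_neq0 Mnd.
have [MM Mdiv] := Mnd; have [MR M1 Mmax] := MM.
apply: contrapT => pM.
have {}pM m : carrier M m%:F -> loc M (line p%:F) m%:F.
  by move=> Mm; apply: contrapT => pm; apply: pM; exists m.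
have p0 : p != 0.
  apply: contraNneq a0 => p0; have [t Mt [r /eqP]] := pM a Ma.
  rewrite p0 tofrac0 mulr0 mulf_eq0 !tofrac_eq0 => /orP[/eqP t0|//].
  by case: Mt; rewrite t0 tofrac0; exact: submod0 (submodP M).
have [B [Bfg BM Bp Brad]] := fg_radical hn MR Mp.
have BR : is_ideal B by exact: subset_trans MR.
have BME : B = M.
  apply: submod_ext => x; split=> [/BM //|Mx]; have [m _ mE] := MR _ Mx.
  rewrite -mE in Mx *; have [//|[N NM nBm]] := loc_global B m%:F.
  have NME := not_loc_isolated MM BR Brad NM nBm.
  by case: nBm; rewrite NME; apply: loc_mono (pM m Mx); exact: line_le.
have B0 : carrier B <> [set 0].
  by move=> B0; move: Bp; rewrite B0 => /eqP; rewrite tofrac_eq0 (negPf p0).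
by apply: Mdiv; rewrite -BME; apply: invertible_divisorial => //; exact: hp.
Qed.

(** Some m in M is outside p R_M, so p/m is in M R_M. *)
Lemma nondivisorial_idempotent M (p : R) : is_prufer R -> noetherian_spectrum R ->
  nondivisorial_max R M -> carrier M p%:F ->
  exists t a b : R, [/\ ~ carrier M t%:F, carrier M a%:F, carrier M b%:F &
    t * p = a * b].
Proof.
move=> hp hn Mnd Mp; have [m Mm pm] := nondivisorial_gap hp hn Mnd Mp.
have SM : Spec R M by apply: maximal_prime; case: Mnd.
have [t [r [Mt Mr E]]] := loc_dvd hp SM pm (line_mem p%:F).
exists t, r, m; split=> //.
by apply/eqP; rewrite -tofrac_eq !tofracM E.
Qed.

(** If x is outside R_M, then 1/x = r/t is in M R_M, and x M inside R_M would
    put M R_M inside r R_M. *)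
Lemma almost_loc_ring M x : is_prufer R -> noetherian_spectrum R ->
  nondivisorial_max R M ->
  almost_loc M (ring_submod R) x -> loc M (ring_submod R) x.
Proof.
move=> hp hn Mnd Mx; apply: contrapT => nx.
have SM : Spec R M by apply: maximal_prime; case: Mnd.
have [t [r [Mt Mr]]] := loc_dvd hp SM nx (ring1 R); rewrite mulr1 => E.
have [m Mm] := nondivisorial_gap hp hn Mnd Mr; apply.
have [u Mu [c _ cE]] := Mx m Mm.
exists (u * t); first exact: prime_notM.
by exists c; rewrite cE tofracM E; ring.
Qed.

Lemma loc_scale M I x y : x != 0 ->
  loc M (scale_submod x I) y <-> loc M I (x^-1 * y).
Proof.
move=> x0; split=> -[t Mt].
  move=> [z Iz zE]; exists t => //.
  by rewrite mulrCA -zE mulKf.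
by move=> It; exists t => //; exists (t%:F * (x^-1 * y)) => //;
  rewrite mulrCA mulVKf.
Qed.

(** * The operation attached to a set of maximal ideals *)

Definition mixed_star D I : submod R := Submod (mixed_closure_is_submod D I).

(** This is the case x = 0 of compatibility with the scaling by x; it uses that
    the members of D are nonzero. *)
Lemma mixed_closure_zero D I x : D `<=` nondivisorial_max R ->
  carrier I = [set 0] -> mixed_closure D I x -> x = 0.
Proof.
move=> DM I0 Ix; have [||M MM _] := @ex_max R (line 0).
- by rewrite -tofrac0; exact: line_ideal.
- by move=> [r /eqP]; rewrite mulr0 oner_eq0.
have loc0 y : loc M I y -> y = 0.
  move=> [t Mt]; rewrite I0 => /eqP; rewrite mulf_eq0 tofrac_eq0 => /orP[/eqP t0|/eqP//].
  by case: Mt; rewrite t0 tofrac0; exact: submod0 (submodP M).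
have [Ix1 Ix2] := Ix M MM; have [DMM|DMM] := pselect (D M); last exact/loc0/Ix1.
have [a a0 Ma] := nondivisorial_neq0 (DM _ DMM).
have /loc0/eqP := Ix2 DMM a Ma.
by rewrite mulf_eq0 tofrac_eq0 (negPf a0) => /eqP.
Qed.

(** Idempotence is the point: applying the closure twice at M in D multiplies x by
    products of two elements of M, and these generate M R_M. *)
Lemma mixed_star_semistar D : is_prufer R -> noetherian_spectrum R ->
  D `<=` nondivisorial_max R -> is_semistar (mixed_star D).
Proof.
move=> hp hn DM.
have ext I : carrier I `<=` mixed_closure D I.
  move=> x Ix M /maximal_prime SM; have Lx := sub_loc SM Ix.
  by split=> _ //; exact: sub_almost_loc.
split=> [//|I|I J|x I].
- apply: submod_ext => x; split; first exact: ext.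
  move=> Ix M MM; have SM := maximal_prime MM; have [Ix1 Ix2] := Ix M MM.
  split=> DMM.
    have [t Mt /(_ M MM)[/(_ DMM) It _]] := Ix1 DMM.
    exact: locK It.
  move=> m Mm; have [t [a [b [Mt Ma Mb E]]]] :=
    nondivisorial_idempotent hp hn (DM _ DMM) Mm.
  have [u Mu /(_ M MM)[_ /(_ DMM a Ma) Iu]] := Ix2 DMM b Mb.
  apply: (locK SM Mt); apply: (locK SM Mu).
  by rewrite [t%:F * _]mulrA -tofracM E tofracM -mulrA mulrCA.
- exact: mixed_closure_mono.
- apply: submod_ext => y; have [->|x0] := eqVneq x 0.
    split=> [/mixed_closure_zero -> //|[z _ <-]].
    + by exists 0; rewrite ?mulr0//; exact: submod0 (submodP _).
    + apply/seteqP; split=> [_ [z _ <-]|_ ->]; first by rewrite /= mul0r.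
      by exists 0; rewrite ?mulr0//; exact: submod0 (submodP _).
    + by rewrite mul0r; exact: submod0 (submodP _).
  have H : mixed_closure D (scale_submod x I) y <-> mixed_closure D I (x^-1 * y).
    split=> Ix M /Ix[Ix1 Ix2]; split=> DMM; try by apply/loc_scale; auto.
      by move=> m Mm; rewrite mulrCA; apply/loc_scale => //; exact: Ix2.
    by move=> m Mm; apply/loc_scale => //; rewrite mulrCA; exact: Ix2.
  apply: (iff_trans H); split=> [Iy|[z Iz <-]]; last by rewrite mulKf.
  by exists (x^-1 * y) => //; rewrite mulVKf.
Qed.

Lemma mixed_star_stable D : is_stable (mixed_star D).
Proof.
move=> I J; apply: submod_ext => x; split=> [IJx|[Ix Jx] M MM].
  by split; apply: mixed_closure_mono IJx => y [].
have SM := maximal_prime MM; have [Ix1 Ix2] := Ix M MM; have [Jx1 Jx2] := Jx M MM.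
split=> DMM; first by apply/loc_cap => //; split; [exact: Ix1|exact: Jx1].
by move=> m Mm; apply/loc_cap => //; split; [exact: Ix2|exact: Jx2].
Qed.

Lemma mixed_star_SStar D : is_prufer R -> noetherian_spectrum R ->
  D `<=` nondivisorial_max R -> SStar_st R (mixed_star D).
Proof.
move=> hp hn DM; have ss := mixed_star_semistar hp hn DM.
split=> //; first exact: mixed_star_stable.
apply: submod_ext => x; split=> [Rx|]; last exact: semistar_ext ss _ x.
have [//|[M MM]] := loc_global (ring_submod R) x; case.
have [Rx1 Rx2] := Rx M MM; have [DMM|/Rx1//] := pselect (D M).
exact: almost_loc_ring (DM _ DMM) (Rx2 DMM).
Qed.

(** * The pseudo-spectrum *)

(** If b is not in M, then b is a unit of R_M, so ab in B gives a in B R_M;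
    at the other maximal ideals B localizes to the whole ring. *)
Lemma maximal_radical_primary M B : Max R M -> carrier B `<=` carrier M ->
  (forall P, Spec R P -> carrier B `<=` carrier P -> carrier M `<=` carrier P) ->
  is_primary M B.
Proof.
move=> MM BM Brad; have SM := maximal_prime MM; have [MR M1 Mmax] := MM.
have BR : is_ideal B by exact: subset_trans MR.
have pow (b : R) : carrier M b%:F -> exists n, carrier B (b ^+ n)%:F.
  move=> Mb; apply: contrapT => nB.
  have [|P [SP BP Pb]] := @ex_prime R B b; last by apply: Pb; exact: Brad.
  by split=> // n Bn; apply: nB; exists n.
split=> // [/BM//|a b Bab|a].
- have [/pow|Mb] := pselect (carrier M b%:F); [by right|left].
  have [//|[N NM nBa]] := loc_global B a%:F.
  have NME := not_loc_isolated MM BR Brad NM nBa; case: nBa; rewrite NME.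
  by exists b => //; rewrite -tofracM mulrC.
- split=> [/pow//|[n /BM]]; elim: n => [|n IHn]; first by rewrite expr0 tofrac1.
  by rewrite exprS; case: SM => _ _ /[apply] -[].
Qed.

Lemma star1_nondivisorial (s : submod R -> submod R) M : SStar_st R s ->
  Max R M -> carrier (s M) 1 -> nondivisorial_max R M.
Proof.
move=> hs MM sM1; split=> // Mdiv; case: (MM) => _ M1 _; apply: M1.
exact: star_divisorial hs _ Mdiv sM1.
Qed.

(** The inclusion from left to right holds because a prime P with 1 in s P
    satisfies P R_M = M R_M at any maximal M above it. *)
Lemma PsSpecE (s : submod R -> submod R) : is_prufer R -> noetherian_spectrum R ->
  SStar_st R s -> PsSpec s = [set M | Max R M /\ carrier (s M) 1].
Proof.
move=> hp hn hs; apply/seteqP; split=> [P [SP sP _]|M [MM sM1]].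
  have {}sP : carrier (s P) 1.
    suff [] : (carrier (s P) `&` ring_image R) 1 by [].
    by rewrite sP; exact: ring1.
  split=> //; have [PR P1 Pp] := SP; have [M MM PM] := ex_max PR P1.
  have [Ix1 Ix2] := star1_mixed_closure hs hp hn PR sP MM.
  have DM : Max R M /\ carrier (s M) 1.
    by apply: contrapT => /Ix1[t Mt Pt]; apply: Mt; apply: PM; rewrite mulr1 in Pt.
  suff -> : P = M by [].
  apply: submod_ext => x; split=> [/PM//|Mx]; have [MR _ _] := MM.
  have [m _ mE] := MR _ Mx; rewrite -mE in Mx *.
  have [t Mt] := Ix2 DM m Mx; rewrite mulr1 -tofracM => /Pp[/PM//|//].
have Mnd := star1_nondivisorial hs MM sM1; have SM := maximal_prime MM.
have [a a0 Ma] := nondivisorial_neq0 Mnd; have [MR M1 _] := MM.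
split=> //.
  apply/seteqP; split=> [x []//|x Rx]; split=> //.
  exact: ideal_full sM1 Rx.
have [B [Bfg BM Ba Brad]] := fg_radical hn MR Ma.
have BR : is_ideal B by exact: subset_trans MR.
exists B; first exact: maximal_radical_primary.
have Binv : invertible B.
  apply: hp => // B0; move: Ba; rewrite B0 => /eqP.
  by rewrite tofrac_eq0 (negPf a0).
apply/seteqP; split=> [x [sBx _]|x Bx]; first exact: star_invertible hs _ Binv _ sBx.
by split; [case: hs => ss _ _; exact: semistar_ext ss _ _ Bx|exact: BR].
Qed.

Lemma PsSpec_nondivisorial (s : submod R -> submod R) :
  is_prufer R -> noetherian_spectrum R -> SStar_st R s ->
  PsSpec s `<=` nondivisorial_max R.
Proof.
by move=> hp hn hs; rewrite PsSpecE// => M [MM sM1]; exact: star1_nondivisorial sM1.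
Qed.

Lemma star_PsSpec (s : submod R -> submod R) I :
  is_prufer R -> noetherian_spectrum R -> SStar_st R s ->
  carrier (s I) = mixed_closure (PsSpec s) I.
Proof. by move=> hp hn hs; rewrite PsSpecE//; exact: star_mixed_closure. Qed.

Lemma PsSpec_mixed_star D : is_prufer R -> noetherian_spectrum R ->
  D `<=` nondivisorial_max R -> PsSpec (mixed_star D) = D.
Proof.
move=> hp hn DM; rewrite PsSpecE//; last exact: mixed_star_SStar.
apply/seteqP; split=> [M [MM M1]|M DMM].
  apply: contrapT => DMM; have [/(_ DMM)[t Mt]] := M1 M MM.
  by rewrite mulr1.
have [MM _] := DM _ DMM; split=> // N MN; have SN := maximal_prime MN.
have [L|L] := pselect (loc N M 1); first by split=> // _; exact: sub_almost_loc.
have MNE : N = M.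
  have [MR M1 Mmax] := MM; have [NR N1 _] := MN; apply: Mmax => //.
  by apply: (@sub_not_loc R _ _ 1) => //; rewrite tofrac1.
by rewrite MNE; split=> // _ m Mm; rewrite mulr1; apply: sub_loc => //; exact: maximal_prime.
Qed.

Lemma mixed_closure_le D D' I : D `<=` D' ->
  mixed_closure D I `<=` mixed_closure D' I.
Proof.
move=> DD x Ix M MM; have SM := maximal_prime MM; have [Ix1 Ix2] := Ix M MM.
split=> [nDM|_]; first by apply: Ix1 => /DD.
by have [/Ix2//|/Ix1] := pselect (D M); exact: sub_almost_loc.
Qed.

(** * Divisorial closure in a localization *)

Lemma localizationE P : localization P = loc P (ring_submod R).
Proof.
apply/seteqP; split=> x [].
  move=> a [t [Pt ->]]; exists t => //; exists a => //.
  rewrite mulrC divfK// tofrac_eq0; apply: contra_notN Pt => /eqP ->.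
  by rewrite tofrac0; exact: submod0 (submodP P).
move=> t Pt [a _ E]; exists a, t; split=> //; rewrite E mulrC mulKf//.
rewrite tofrac_eq0; apply: contra_notN Pt => /eqP ->.
by rewrite tofrac0; exact: submod0 (submodP P).
Qed.

Lemma prodm_localization P I : Spec R P -> prodm I (localization P) = loc P I.
Proof.
move=> SP; rewrite localizationE; apply/seteqP; split=> x.
  move=> [n [a [b [Ia Vb ->]]]].
  apply: (@submod_sum R (Submod (loc_is_submod I SP))) => i /=.
  have [t Pt [r _ E]] := Vb i; exists t => //.
  by rewrite mulrCA -E; exact: submodZr.
move=> [t Pt It]; exists 1%N, (fun=> t%:F * x), (fun=> t%:F^-1).
have t0 : t%:F != 0 :> {fraction R}.
  rewrite tofrac_eq0; apply: contra_notN Pt => /eqP ->.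
  by rewrite tofrac0; exact: submod0 (submodP P).
split=> // [_|]; last by rewrite big_ord1 mulrC mulKf.
by exists t => //; rewrite mulfV//; exact: ring1.
Qed.

(** For x in the divisorial closure of H = I R_P and m in P, if m x were outside
    H then 1/(m x) would send H into R_P and x to 1/m, which is not in R_P.
    Conversely x P R_P inside H and c H inside R_P give c x in
    (R_P : P R_P) = R_P. *)
Lemma vop_loc P I : is_prufer R -> noetherian_spectrum R ->
  nondivisorial_max R P -> vop (localization P) (loc P I) = almost_loc P I.
Proof.
move=> hp hn Pnd; have [MP _] := Pnd; have SP := maximal_prime MP.
have [a a0 Pa] := nondivisorial_neq0 Pnd.
rewrite localizationE /vop; case: asboolP => I0; apply/seteqP; split=> x.
- by move=> ->; exact: submod0 (almost_loc_is_submod _ _).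
- move=> /(_ a Pa); rewrite I0 => /eqP.
  by rewrite mulf_eq0 tofrac_eq0 (negPf a0) => /eqP.
- move=> Vx m Pm; apply: contrapT => nI.
  have mx0 : m%:F * x != 0.
    by apply: contra_notN nI => /eqP ->; exact: submod0 (loc_is_submod _ _).
  have m0 : m%:F != 0 :> {fraction R} by apply: contraNneq mx0 => ->; rewrite mul0r.
  have x0 : x != 0 by apply: contraNneq mx0 => ->; rewrite mulr0.
  have [|t Pt [r _ E]] := Vx (m%:F * x)^-1.
    move=> h [u Pu Iuh]; have [t [r [Pt _ E]]] := loc_dvd hp SP nI Iuh.
    exists (t * u); first exact: prime_notM.
    exists r => //; apply: (mulIf mx0).
    by rewrite -E [_^-1 * h]mulrC -[RHS]mulrA divfK// tofracM -mulrA.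
  apply: Pt; have -> : t%:F = r%:F * m%:F.
    by apply/esym; rewrite E invfM mulrC [x * _]mulrCA mulfV// mulr1 mulrCA mulfV// mulr1.
  exact: submodZ (submodP P) _ _ Pm.
- move=> Ix c Vc; apply: almost_loc_ring => // m Pm.
  by rewrite mulrA mulrC; apply: Vc; exact: Ix.
Qed.

End Nondivisorial.

(** * The classification *)

Theorem proposition4p11 (R : idomainType)
    (hprufer : is_prufer R) (hnoeth : noetherian_spectrum R) :
  [/\ forall s : submod R -> submod R, SStar_st R s ->
        exists D1 D2 : set (submod R),
          [/\ D1 `<=` Max R, D2 `<=` Max R, D1 `&` D2 = set0,
              Max R = D1 `|` D2 &
              forall I : submod R,
                carrier (s I) =
                  (\bigcap_(P in D1) prodm I (localization P)) `&`
                  (\bigcap_(P in D2)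
                     vop (localization P) (prodm I (localization P)))],
      set_bij (SStar_st R) [set A | A `<=` nondivisorial_max R] (@PsSpec R) /\
      (forall s1 s2 : submod R -> submod R,
         SStar_st R s1 -> SStar_st R s2 ->
         (semistar_le s1 s2 <-> PsSpec s1 `<=` PsSpec s2)) &
      SStar_st R #= [set: nondivisorial_max R -> bool]].
Proof.
have le_PsSpec (s1 s2 : submod R -> submod R) : SStar_st R s1 -> SStar_st R s2 ->
    (semistar_le s1 s2 <-> PsSpec s1 `<=` PsSpec s2).
  move=> hs1 hs2; split=> [s12|P12 I].
    by rewrite !PsSpecE// => M [MM /s12].
  by rewrite !star_PsSpec//; exact: mixed_closure_le.
have PsSpec_inj (s1 s2 : submod R -> submod R) : SStar_st R s1 -> SStar_st R s2 ->
    PsSpec s1 = PsSpec s2 -> s1 = s2.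
  move=> hs1 hs2 E; apply/funext => I; apply: submod_ext => x.
  by rewrite !star_PsSpec// E.
split.
- move=> s hs; exists (Max R `\` PsSpec s), (PsSpec s).
  have PM : PsSpec s `<=` Max R by rewrite PsSpecE// => M [].
  split=> //.
  + by apply/seteqP; split=> // M [[]].
  + apply/seteqP; split=> [M MM|M [[]//|/PM//]].
    by have [|] := pselect (PsSpec s M); [right|left].
  + move=> I; rewrite star_PsSpec//; apply/seteqP; split=> x.
      move=> Ix; split=> M.
        move=> [MM PsM]; rewrite prodm_localization; last exact: maximal_prime.
        by have [+ _] := Ix M MM; exact.
      move=> PsM; have Mnd := PsSpec_nondivisorial hprufer hnoeth hs PsM.
      rewrite prodm_localization; last exact/maximal_prime/PM.
      by rewrite vop_loc//; have [_] := Ix M (PM _ PsM); exact.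
    move=> [Ix1 Ix2] M MM; split=> PsM.
      by have := Ix1 M (conj MM PsM); rewrite prodm_localization//; exact: maximal_prime.
    have := Ix2 M PsM; rewrite prodm_localization; last exact: maximal_prime.
    by rewrite vop_loc//; exact: PsSpec_nondivisorial PsM.
- split=> //; split.
  + by move=> s hs; exact: PsSpec_nondivisorial.
  + by move=> s1 s2 /[!inE]; exact: PsSpec_inj.
  + move=> D DM; exists (mixed_star D); first exact: mixed_star_SStar.
    exact: PsSpec_mixed_star.
- apply/card_set_bijP.
  exists (fun s (M : nondivisorial_max R) => `[< PsSpec s (set_val M) >]); split=> //.
  + move=> s1 s2 /[!inE] hs1 hs2 E; apply: PsSpec_inj => //.
    have sub (s s' : submod R -> submod R) : SStar_st R s ->
        (forall M : nondivisorial_max R, `[< PsSpec s (set_val M) >] = `[< PsSpec s' (set_val M) >]) ->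
        PsSpec s `<=` PsSpec s'.
      move=> hs ss' M PsM; have Mnd := PsSpec_nondivisorial hprufer hnoeth hs PsM.
      have := ss' (SigSub (mem_set Mnd)); rewrite set_valE /= asboolT// => /esym/asboolP.
      by [].
    apply/seteqP; split; apply: sub => // M; first by rewrite (congr1 (@^~ M) E).
    by rewrite -(congr1 (@^~ M) E).
  + move=> f _; pose D := [set M | exists Mnd : nondivisorial_max R M, f (SigSub (mem_set Mnd))].
    have DM : D `<=` nondivisorial_max R by move=> M [].
    exists (mixed_star D); first exact: mixed_star_SStar.
    apply/funext => M; rewrite PsSpec_mixed_star//.
    apply/asboolP/idP.
    * move=> [Mnd fM]; suff <- : SigSub (mem_set Mnd) = M by [].
      exact: val_inj.
    * case: M => M MP fM; exists (set_mem MP).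
      suff -> : SigSub (mem_set (set_mem MP)) = SigSub MP by [].
      exact: val_inj.
Qed.
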